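(* Let $\mathbf{F}_q$ be a finite field of characteristic $p$ with $q>2$. For every integer $1\le k\le q-2$ and every $b\in\mathbf{F}_q$, $$N(k,b,\mathbf{F}_q\setminus\{0,1\})=\frac1q\binom{q-2}{k}+\frac1q(-1)^kR^2_k-(-1)^kS(k,k-b),$$ where $k-b$ is computed in $\mathbf{F}_q$ (the integer $k$ being viewed in the prime field $\mathbf{F}_p$).
   Context: $N(k,b,D)$ denotes the number of $k$-element subsets $\{x_1,\dots,x_k\}\subseteq D$ with $x_1+\dots+x_k=b$. Binomial coefficients $\binom{x}{m}=x(x-1)\cdots(x-m+1)/m!$ for real $x$, integer $m\ge0$ (so e.g. $\binom{0}{m}=[m=0]$ and $\binom{-1}{m}=(-1)^m$). For integers $j\ge0$ define $R^1_j=-(-1)^{\lfloor j/p\rfloor}\binom{q/p-1}{\lfloor j/p\rfloor}$ and $R^2_k=\sum_{j=0}^kR^1_j$. For an integer $k\ge0$ and $c\in\mathbf{F}_q$ define $S(k,c)=\sum_{0\le i\le k,\ i\equiv c \pmod p}R^1_i$ if $c$ lies in the prime subfield $\mathbf{F}_p$ (where $i\equiv c$ means the image of $i$ in $\mathbf{F}_p$ equals $c$), and $S(k,c)=0$ if $c\notin\mathbf{F}_p$. *)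

(* Defs.v *)
From HB Require Import structures.
From mathcomp Require Import all_boot all_order all_algebra all_field.
Set Implicit Arguments. Unset Strict Implicit. Unset Printing Implicit Defensive.
Import Order.TTheory GRing.Theory Num.Theory.
Local Open Scope ring_scope.

Definition gbinom (x : rat) (m : nat) : rat :=
  (\prod_(i < m) (x - i%:R)) / (m`!)%:R.

Definition R1 (p q j : nat) : rat :=
  - ((-1) ^+ (j %/ p)%N * gbinom (q%:R / p%:R - 1) (j %/ p)%N).

Definition R2 (p q k : nat) : rat := \sum_(0 <= j < k.+1) R1 p q j.

Definition in_prime_subfield (F : finFieldType) (c : F) : bool :=
  [exists i : 'I_#|F|.+1, (i : nat)%:R == c].

Definition S (F : finFieldType) (p : nat) (k : nat) (c : F) : rat :=
  if in_prime_subfield c then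
    \sum_(0 <= i < k.+1 | (i%:R : F) == c) R1 p #|F| i
  else 0.

Definition Nsub (F : finFieldType) (k : nat) (b : F) (D : {set F}) : nat :=
  #|[set A : {set F} | [&& A \subset D, #|A| == k & \sum_(x in A) x == b]]|.

(* Main.v *)
(** Write N(k, b) for the number of k-subsets of F^* with sum b.  Counting pairs
    (A, x) with x in A, where A is a (k+1)-subset of F with sum b, and
    translating A by -x gives
      (k+1) (N(k+1, b) + N(k, b)) = sum_x N(k, b - (k+1) x).
    The right-hand side is q N(k, b) when p divides k+1, and the number
    C(q-1, k) of all k-subsets of F^* otherwise.  This recursion determines
    N(k, b); removing 1 from F^* as well leads to the recursion
    N(k+1, b) = M(k+1, b) + M(k, b-1) for the numbers M(k, b) of k-subsets of
    F \ {0, 1} with sum b. *)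

Require Import Defs.
From HB Require Import structures.
From mathcomp Require Import all_boot all_order all_algebra all_field.
From mathcomp Require Import ring.
Import Order.TTheory GRing.Theory Num.Theory.
Local Open Scope ring_scope.

Lemma gbinomS (x : rat) (m : nat) :
  gbinom x m.+1 = gbinom x m * (x - m%:R) / m.+1%:R.
Proof.
rewrite /gbinom big_ord_recr factS natrM invfM /=.
ring.
Qed.

Lemma R1_0 (p q : nat) : R1 p q 0 = -1.
Proof. by rewrite /R1 div0n /gbinom big_ord0 fact0 !(expr0, mul1r, invr1). Qed.

(** The quotient [k %/ p] grows only when [p] divides [k.+1]. With [k.+1 = (m + 1) p], the sign and
    the binomial then contribute the factor $-(q/p - 1 - m)/(m + 1) = 1 - q/(k+1)$. *)
Lemma R1S (p q k : nat) : (0 < p)%N ->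
  R1 p q k.+1 =
    if (p %| k.+1)%N then (1 - q%:R / k.+1%:R) * R1 p q k else R1 p q k.
Proof.
move=> p_gt0; rewrite /R1 divnS //; case: ifP => [pk|//].
have -> : k.+1 = ((k %/ p).+1 * p)%N.
  by rewrite -[LHS](divnK pk) divnS // pk add1n.
rewrite add1n gbinomS exprS natrM; set m := (k %/ p)%N.
have p0 : p%:R != 0 :> rat by rewrite pnatr_eq0 -lt0n.
have m0 : m.+1%:R != 0 :> rat by rewrite pnatr_eq0.
move: m0; rewrite -natr1 => m0.
by field; rewrite m0 p0.
Qed.

Section SubsetSums.

Variable F : finFieldType.
Implicit Types (D A : {set F}) (a b x : F) (k : nat).

Lemma Nsub0 b D : Nsub 0 b D = (b == 0).
Proof.
rewrite /Nsub; case: eqP => [->|/eqP b0].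
  apply: (@eq_card1 _ set0) => A; rewrite !inE cards_eq0 andbA.
  case: eqVneq => [->|_]; last by rewrite andbF.
  by rewrite sub0set big_set0 eqxx.
apply: eq_card0 => A; rewrite !inE cards_eq0; apply/and3P => -[_ /eqP ->].
by rewrite big_set0 eq_sym (negPf b0).
Qed.

Lemma Nsub_total k D : (\sum_b Nsub k b D)%N = 'C(#|D|, k).
Proof.
rewrite -cards_draws -sum1_card.
rewrite (partition_big (fun A => \sum_(x in A) x) predT) //=.
apply: eq_bigr => b _; rewrite /Nsub -sum1_card.
by apply: eq_bigl => A; rewrite !inE andbA.
Qed.

(** Inserting [a] is a bijection from the subsets of [D] onto the subsets of [a |: D] containing
    [a]; it raises the cardinality by 1 and the sum by [a]. *)
Lemma card_subset_sum_with k b a D : a \notin D ->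
  #|[set A : {set F} | [&& A \subset a |: D, #|A| == k.+1,
      \sum_(x in A) x == b & a \in A]]| = Nsub k (b - a) D.
Proof.
move=> aD; rewrite /Nsub.
rewrite -(@card_in_imset _ _ (fun A : {set F} => a |: A)
  [set A : {set F} | [&& A \subset D, #|A| == k & \sum_(x in A) x == b - a]]).
  apply: eq_card => A; rewrite inE; apply/idP/imsetP.
    case/and4P=> sAD /eqP cA /eqP sA aA; exists (A :\ a); last by rewrite setD1K.
    rewrite inE subDset sAD -sA (big_setD1 a aA) /= addrAC subrr add0r eqxx.
    by rewrite andbT -eqSS -cA [in eqbRHS](cardsD1 a A) aA.
  case=> B; rewrite inE => /and3P [sBD /eqP cB /eqP sB] ->.
  have aB : a \notin B by apply: contra aD; apply/subsetP.
  by rewrite setUS // cardsU1 aB cB big_setU1 //= sB addrC subrK !eqxx setU11.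
have aX (B : {set F}) : B \subset D -> a \notin B by move=> s; apply: contra aD; apply/subsetP.
move=> A B; rewrite !inE => /and3P [/aX aA _ _] /and3P [/aX aB _ _] /= e.
by rewrite -(setU1K aA) e setU1K.
Qed.

Lemma Nsub_setU1 k b a D : a \notin D ->
  Nsub k.+1 b (a |: D) = (Nsub k.+1 b D + Nsub k (b - a)%R D)%N.
Proof.
move=> aD; rewrite -(card_subset_sum_with k b a D aD) addnC.
rewrite {1}/Nsub -(cardsID [set A : {set F} | a \in A]).
congr (_ + _)%N; apply: eq_card => A; rewrite !inE -?andbA //.
case aA: (a \in A) => /=.
  by apply/esym/and3P => -[/subsetP /(_ _ aA)]; rewrite (negPf aD).
by rewrite -{2}(setU1K aD) subsetD1 aA andbT.
Qed.

Lemma card_subset_sum_containing k b x :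
  #|[set A : {set F} | [&& #|A| == k.+1, \sum_(y in A) y == b & x \in A]]|
    = Nsub k (b - k.+1%:R * x) (~: [set 0]).
Proof.
(* Taking [a = 0] turns the right-hand side into a count of (k+1)-sets containing 0. Translation by
   [x] maps these onto the sets containing [x] and adds $(k+1)x$ to the sum. *)
have := card_subset_sum_with k (b - k.+1%:R * x) 0 (~: [set 0]).
rewrite subr0 !inE eqxx => /(_ isT) <-; rewrite setUCr.
have inj : injective (fun A : {set F} => [set y + x | y in A]).
  by apply: imset_inj; apply: addIr.
rewrite -[RHS](card_imset _ inj); apply: eq_card => A; rewrite inE.
have sh (B : {set F}) : \sum_(y in [set y + x | y in B]) y = \sum_(y in B) y + #|B|%:R * x.
  rewrite big_imset /=; last by move=> ? ? _ _; apply: addIr.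
  by rewrite big_split sumr_const mulr_natl.
apply/idP/imsetP => [/and3P [/eqP cA /eqP sA xA]|[B]].
  have AE : A = [set y + x | y in [set y - x | y in A]].
    rewrite -imset_comp -[LHS]imset_id; apply: eq_imset => y /=.
    by rewrite subrK.
  have cB : #|[set y - x | y in A]| = k.+1 by rewrite card_imset //; apply: addIr.
  exists [set y - x | y in A] => //; rewrite inE subsetT cB eqxx /=.
  rewrite -sA {2}AE sh cB addrK eqxx /=.
  by apply/imsetP; exists x; rewrite ?subrr.
rewrite inE => /and4P [_ /eqP cB /eqP sB B0] ->.
rewrite sh card_imset ?cB ?sB ?subrK ?eqxx /=; last exact: addIr.
by apply/imsetP; exists 0; rewrite ?add0r.
Qed.

Lemma Nsub_translation k b :
  (k.+1 * Nsub k.+1 b setT)%N =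
    (\sum_x Nsub k (b - k.+1%:R * x)%R (~: [set 0%R : F]))%N.
Proof.
under eq_bigr => x _ do rewrite -card_subset_sum_containing -sum1_card.
rewrite /Nsub mulnC -sum_nat_const.
under [RHS]eq_bigr => x _ do under eq_bigl => A do rewrite inE.
(* Once the sums are swapped, each [A] is counted once for every [x] in it, that is [k.+1] times. *)
rewrite (exchange_big_dep
  [pred A : {set F} | (#|A| == k.+1) && (\sum_(y in A) y == b)]) /=.
  apply: eq_big => [A|A]; rewrite ?inE ?subsetT //=.
  case/andP=> /eqP cA sA; rewrite -[LHS]cA -[LHS]sum1_card; apply: eq_bigl => x.
  by rewrite cA sA eqxx.
by move=> x A _ /and3P [-> ->].
Qed.

Variables (p : nat) (hp : p \in [pchar F]).
Local Notation q := #|F|.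

Let p_gt0 : (0 < p)%N. Proof. exact/prime_gt0/(pcharf_prime hp). Qed.

Let q_neq0 : q%:R != 0 :> rat.
Proof. by rewrite pnatr_eq0 -lt0n; apply/card_gt0P; exists 0. Qed.

Lemma Nsub_nonzeroS k b :
  (k.+1 * (Nsub k.+1 b (~: [set 0%R]) + Nsub k b (~: [set 0%R])))%N =
    (if (p %| k.+1)%N then q * Nsub k b (~: [set 0%R]) else 'C(q.-1, k))%N.
Proof.
have := Nsub_setU1 k b 0 (~: [set 0]).
rewrite !inE eqxx setUCr subr0 => /(_ isT) <-.
rewrite Nsub_translation (dvdn_pcharf hp); case: eqVneq => [->|k0].
  by under eq_bigr => x _ do rewrite mul0r subr0; rewrite sum_nat_const.
(* As $k+1$ is invertible in [F], the target sum $b - (k+1)x$ takes every value exactly once, so all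
   k-subsets are counted. *)
rewrite -(cardsC1 (0 : F)) -Nsub_total [RHS](reindex (fun x => b - k.+1%:R * x)) //.
exists (fun y => k.+1%:R^-1 * (b - y)) => x _.
  by rewrite opprB addrC subrK mulKf.
by rewrite mulVKf // opprB addrC subrK.
Qed.

(** The main term is the average over [b]. The recursion multiplies the deviation from it by
    $q/(k+1) - 1$ when $p$ divides $k+1$ and by $-1$ otherwise, which is how $(-1)^k R^1_k$ evolves
    by [R1S]; at $k = 0$ the deviation is $[b = 0] - 1/q$. *)
Lemma Nsub_nonzero k b :
  (Nsub k b (~: [set 0]))%:R =
    'C(q.-1, k)%:R / q%:R
    - (-1) ^+ k * R1 p q k * ((b == 0)%:R - q%:R^-1) :> rat.
Proof.
elim: k => [|k IH]; first by rewrite Nsub0 bin0 R1_0 expr0; ring.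
have k0 : k.+1%:R != 0 :> rat by rewrite pnatr_eq0.
have k1 : 1 + k%:R != 0 :> rat by rewrite nat1r.
have q1 : q = q.-1.+1 by rewrite prednK // lt0n -(pnatr_eq0 rat).
have pascal : k.+1%:R * ('C(q.-1, k.+1)%:R + 'C(q.-1, k)%:R)
    = q%:R * 'C(q.-1, k)%:R :> rat.
  by rewrite -natrD -binS -q1 -!natrM mul_bin_diag.
have := congr1 (fun n => n%:R : rat) (Nsub_nonzeroS k b).
rewrite R1S // exprS natrM natrD.
have -> : 'C(q.-1, k.+1)%:R = (q%:R / k.+1%:R - 1) * 'C(q.-1, k)%:R :> rat.
  apply: (mulfI k0); move: pascal; rewrite mulrDr => /(canRL (addrK _)) ->.
  by field.
case: ifP => _ rec; apply: (mulfI k0).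
  move: rec; rewrite natrM mulrDr IH => /(canRL (addrK _)) ->.
  by field; rewrite k1 q_neq0.
move: rec; rewrite mulrDr IH => /(canRL (addrK _)) ->.
by field; rewrite k1 q_neq0.
Qed.

(** [in_prime_subfield] tests the integers up to [q], so for [k <= q] a failed test means that no
    index satisfies the congruence and the sum is empty. *)
Lemma S_sum k (c : F) : (k <= q)%N ->
  S p k c = \sum_(0 <= i < k.+1 | (i%:R : F) == c) R1 p q i.
Proof.
move=> kq; rewrite /S; case: ifP => // /negbT /existsPn nc.
rewrite big_nat_cond big1 // => i /andP [/andP [_ ik] ic].
have iq : (i < q.+1)%N by apply: leq_trans ik _.
by have := nc (Ordinal iq); rewrite ic.
Qed.

(** Induction on [k] from 0, with [b] general because the recursion calls the previous case at
    [b - 1]. *)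
Lemma Nsub_nonzero_nonone k b : (1 < q)%N -> (k <= q)%N ->
  (Nsub k b (~: [set 0; 1]))%:R =
    q%:R^-1 * ('C(q - 2, k))%:R + q%:R^-1 * ((-1) ^+ k * R2 p q k)
    - (-1) ^+ k * S p k (k%:R - b) :> rat.
Proof.
move=> q_gt1.
have natB (n : nat) (c : F) : (n%:R == n%:R - c) = (c == 0).
  by rewrite -subr_eq0 opprB addrC subrK.
elim: k b => [|k IH] b kq.
  rewrite Nsub0 S_sum // bin0 /R2 big_nat1 big_mkcond big_nat1 R1_0.
  by rewrite natB expr0; case: (b == 0) => /=; ring.
have := Nsub_setU1 k b 1 (~: [set 0; 1]).
have -> : 1 |: ~: [set 0; 1] = ~: [set 0 : F].
  by apply/setP => x; rewrite !inE; case: (eqVneq x 1) => [->|_]; rewrite ?oner_eq0 ?orbF.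
rewrite !inE eqxx orbT => /(_ isT) /(congr1 (fun n => n%:R : rat)).
rewrite natrD Nsub_nonzero (IH _ (ltnW kq)) => /esym /(canRL (addrK _)) ->.
have -> : q.-1 = (q - 2).+1 by rewrite -subn1 -subSn.
rewrite binS natrD !S_sum ?(ltnW kq) // {2}/R2 [in RHS]big_nat_recr //=.
(* The top index $k+1$ enters [S] exactly when $b = 0$, matching the indicator in [Nsub_nonzero]. *)
rewrite -/(R2 p q k) [in RHS]big_mkcond [in RHS]big_nat_recr //= -big_mkcond natB.
(* Both values of [S] thus sum over the same residue class, so below the top index they agree. *)
have -> : k.+1%:R - b = k%:R - (b - 1) by rewrite -natr1; ring.
rewrite exprS; set s := \sum_(_ <= _ < _ | _) _.
by case: (b == 0) => /=; field.
Qed.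

End SubsetSums.

Theorem theorem1p3 (F : finFieldType) (p : nat) (hp : p \in [pchar F])
  (hq : (2 < #|F|)%N) (k : nat) (hk1 : (1 <= k)%N) (hk2 : (k <= #|F| - 2)%N)
  (b : F) :
  (Nsub k b (~: [set 0; 1]))%:R =
    (#|F|%:R)^-1 * ('C(#|F| - 2, k))%:R
    + (#|F|%:R)^-1 * ((-1) ^+ k * R2 p #|F| k)
    - (-1) ^+ k * S p k (k%:R - b) :> rat.
Proof.
apply: Nsub_nonzero_nonone => //; first exact: ltnW.
exact: leq_trans hk2 (leq_subr _ _).
Qed.
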